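(* If $n>16$ is an integer, then $\mathfrak{pr}(K_n\odot \overline{K}_2)=p_{n-1}$.
   Context: $p_i$ denotes the $i$-th prime number ($p_1=2$). $K_n$ is the complete graph on $n$ vertices and $\overline{K}_2$ is the empty graph on $2$ isolated vertices. The corona $G\odot H$ of a graph $G$ with $|V(G)|=n$ and a graph $H$ is obtained from one copy of $G$ and $n$ copies of $H$ by joining the $i$-th vertex of $G$ to every vertex of the $i$-th copy of $H$. All graphs are finite and simple. A coprime labeling of a graph $G$ of order $N$ is an assignment of distinct labels from $\{1,\ldots,M\}$, for some integer $M\ge N$, to the vertices of $G$ such that adjacent vertices receive relatively prime labels. The minimum coprime number $\mathfrak{pr}(G)$ is the minimum value $M$ for which such a labeling exists. *)

(* Defs.v *)
From mathcomp Require Import all_boot.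
Set Implicit Arguments.
Unset Strict Implicit.
Unset Printing Implicit Defensive.

Record sgraph := SGraph {
  vertex :> finType;
  edge : rel vertex;
  edge_sym : symmetric edge;
  edge_irrefl : irreflexive edge }.

Definition complete_edge (n : nat) : rel 'I_n := [rel x y | x != y].
Definition empty_edge (n : nat) : rel 'I_n := [rel _ _ | false].

Lemma complete_edge_sym n : symmetric (@complete_edge n).
Proof. by move=> x y; rewrite /complete_edge /= eq_sym. Qed.

Lemma complete_edge_irrefl n : irreflexive (@complete_edge n).
Proof. by move=> x; rewrite /complete_edge /= eqxx. Qed.

Lemma empty_edge_sym n : symmetric (@empty_edge n).
Proof. by []. Qed.

Lemma empty_edge_irrefl n : irreflexive (@empty_edge n).
Proof. by []. Qed.

Definition complete_graph (n : nat) : sgraph :=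
  SGraph (@complete_edge_sym n) (@complete_edge_irrefl n).

Definition empty_graph (n : nat) : sgraph :=
  SGraph (@empty_edge_sym n) (@empty_edge_irrefl n).

(* [inl x] is the vertex x of G; [inr (x, u)] is the vertex u of the copy of H
   attached to x. *)
Definition corona_edge (G H : sgraph) : rel (G + G * H)%type :=
  fun a b => match a, b with
  | inl x, inl y => edge x y
  | inl x, inr (y, _) => x == y
  | inr (x, _), inl y => x == y
  | inr (x, u), inr (y, v) => (x == y) && edge u v
  end.
Arguments corona_edge : clear implicits.

Lemma corona_edge_sym G H : symmetric (corona_edge G H).
Proof.
move=> [x|[x u]] [y|[y v]] /=; rewrite 1?[y == x]eq_sym //; first exact: edge_sym.
by rewrite [edge u v]edge_sym.
Qed.

Lemma corona_edge_irrefl G H : irreflexive (corona_edge G H).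
Proof. by move=> [x|[x u]] /=; rewrite edge_irrefl ?andbF. Qed.

Definition corona (G H : sgraph) : sgraph :=
  SGraph (@corona_edge_sym G H) (@corona_edge_irrefl G H).

Lemma exists_prime_above (m : nat) : exists p, prime p && (m < p).
Proof. by have [p lt_mp pr_p] := prime_above m; exists p; rewrite pr_p. Qed.

Definition next_prime (m : nat) : nat := ex_minn (exists_prime_above m).

(* One-based: nth_prime 1 = 2; the value nth_prime 0 = 0 is a convention. *)
Definition nth_prime (i : nat) : nat := iter i next_prime 0.

Definition coprime_labeling (G : sgraph) (M : nat) (f : {ffun G -> 'I_M.+1}) :
  bool :=
  [&& [forall x, 0 < f x], injectiveb f &
      [forall x, forall y, edge x y ==> coprime (f x) (f y)]].

Definition has_coprime_labeling (G : sgraph) (M : nat) : bool :=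
  (#|G| <= M) && [exists f : {ffun G -> 'I_M.+1}, coprime_labeling f].

Lemma next_prime_prime m : prime (next_prime m).
Proof. by rewrite /next_prime; case: ex_minnP => p /andP[]. Qed.

Lemma next_prime_gt m : m < next_prime m.
Proof. by rewrite /next_prime; case: ex_minnP => p /andP[]. Qed.

Lemma ltn_nth_prime i j : i < j -> nth_prime i < nth_prime j.
Proof.
apply: (homo_ltn (r := fun a b => a < b)) => [a b c|k]; first exact: ltn_trans.
exact: next_prime_gt.
Qed.

Lemma nth_prime_inj : injective nth_prime.
Proof.
by move=> i j e; case: (ltngtP i j) => // /ltn_nth_prime; rewrite e ltnn.
Qed.

Lemma exists_coprime_labeling (G : sgraph) :
  exists M, has_coprime_labeling G M.
Proof.
pose M := maxn #|G| (nth_prime #|G|).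
pose f := [ffun x : G => inord (nth_prime (enum_rank x).+1) : 'I_M.+1].
have fE x : f x = nth_prime (enum_rank x).+1 :> nat.
  rewrite ffunE inordK // ltnS leq_max; apply/orP; right.
  have := ltn_ord (enum_rank x); rewrite leq_eqVlt => /predU1P[-> //|].
  by move/ltn_nth_prime/ltnW.
have f_inj : injective f.
  move=> x y /(congr1 val); rewrite /= !fE => /nth_prime_inj [].
  by move/val_inj/enum_rank_inj.
exists M; rewrite /has_coprime_labeling leq_maxl; apply/existsP; exists f.
apply/and3P; split; last 1 first.
- apply/forallP=> x; apply/forallP=> y; apply/implyP=> xy.
  rewrite !fE prime_coprime ?next_prime_prime //.
  rewrite dvdn_prime2 ?next_prime_prime // -!fE.
  by apply: contraTneq xy => /val_inj/f_inj ->; rewrite edge_irrefl.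
- by apply/forallP=> x; rewrite fE prime_gt0 ?next_prime_prime.
- exact/injectiveP.
Qed.

Definition min_coprime_number (G : sgraph) : nat :=
  ex_minn (exists_coprime_labeling G).

(* Main.v *)
Require Import Defs.
From mathcomp Require Import all_boot.
From mathcomp Require Import zify.

(** Lower bound.  The n hubs carry pairwise coprime labels, at most one of
    which is 1; the others have distinct least prime factors, so n - 1 distinct
    primes are at most M and [nth_prime (n - 1) <= M]
    ([pairwise_coprime_size]).

    Upper bound.  A labeling of the corona on n hubs by 1, ..., q with
    [q = nth_prime (n - 1)] extends to n + 1 hubs as soon as the next prime
    q' is at least 3n + 3: the new hub gets q', and of the q' - 1 smaller
    numbers only 3n are taken, so two of them are free for its pendants.
    Everything positive below q' is coprime to q', hence any two free numbers
    will do and no condition with the old hubs can fail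
    ([extend_corona_labels]).  The inequality [3 * k.+1 <= nth_prime k] holds
    for all k from 16 on, because primes above 3 are 1 or 5 modulo 6 and so
    gain at least 6 every two steps ([nth_prime_ge]).  It fails at k = 15
    (47 < 48), where even the 48 vertices do not fit; the induction therefore
    starts at n = 17 with an explicit labeling by 1, ..., 53
    ([base_corona_labels]). *)

(** * The sequence of primes *)

Lemma next_prime_le m p : prime p -> m < p -> next_prime m <= p.
Proof.
by move=> pr_p lt_mp; rewrite /next_prime; case: ex_minnP => q _; apply; apply/andP.
Qed.

Lemma next_primeE m p :
  [&& prime p, m < p & all (predC prime) (iota m.+1 (p - m.+1))] ->
  next_prime m = p.
Proof.
case/and3P=> pr_p lt_mp /allP no_prime; apply/eqP.
rewrite eqn_leq next_prime_le //= leqNgt; apply/negP => lt_next.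
have := no_prime (next_prime m); rewrite /= next_prime_prime mem_iota.
have := next_prime_gt m; lia.
Qed.

Lemma nth_prime_prime k : prime (nth_prime k.+1).
Proof. exact: next_prime_prime. Qed.

Lemma nth_prime16 : nth_prime 16 = 53.
Proof.
rewrite /nth_prime /=.
rewrite (@next_primeE 0 2) // (@next_primeE 2 3) // (@next_primeE 3 5) //.
rewrite (@next_primeE 5 7) // (@next_primeE 7 11) // (@next_primeE 11 13) //.
rewrite (@next_primeE 13 17) // (@next_primeE 17 19) // (@next_primeE 19 23) //.
rewrite (@next_primeE 23 29) // (@next_primeE 29 31) // (@next_primeE 31 37) //.
rewrite (@next_primeE 37 41) // (@next_primeE 41 43) // (@next_primeE 43 47) //.
by rewrite (@next_primeE 47 53).
Qed.

Lemma nth_prime17 : nth_prime 17 = 59.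
Proof.
by rewrite -[LHS]/(next_prime (nth_prime 16)) nth_prime16 (@next_primeE 53 59).
Qed.

Lemma prime_mod6 p : prime p -> 3 < p -> (p %% 6 == 1) || (p %% 6 == 5).
Proof.
move=> pr_p gt3p.
have : ~~ (2 %| p) by rewrite dvdn_prime2 //; lia.
have : ~~ (3 %| p) by rewrite dvdn_prime2 //; lia.
lia.
Qed.

(** The gaps between consecutive numbers that are 1 or 5 modulo 6 alternate
    between 2 and 4, so any two consecutive gaps add up to 6. *)
Lemma next_prime_next_prime p :
  prime p -> 3 < p -> p + 6 <= next_prime (next_prime p).
Proof.
move=> pr_p gt3p; set q := next_prime p; set r := next_prime q.
have lt_pq : p < q := next_prime_gt p.
have lt_qr : q < r := next_prime_gt q.
have := prime_mod6 _ pr_p gt3p.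
have := prime_mod6 q (next_prime_prime p); have := prime_mod6 r (next_prime_prime q).
lia.
Qed.

Lemma nth_prime_ge k : 16 <= k -> 3 * k.+1 <= nth_prime k.
Proof.
move=> ge16; rewrite -(subnK ge16); move: (k - 16) => {k ge16} j.
(* Two consecutive cases are carried along, since the gain is over two steps. *)
suff [] : 3 * (j + 16).+1 <= nth_prime (j + 16) /\
          3 * (j + 17).+1 <= nth_prime (j + 17) by [].
elim: j => [|j [IH0 IH1]].
  by rewrite !add0n nth_prime16 nth_prime17.
have step : nth_prime (j + 16) + 6 <= nth_prime (j + 18).
  have [-> e] : j + 18 = (j + 16).+2 /\ j + 16 = (j + 15).+1 by lia.
  apply: next_prime_next_prime; first by rewrite e; apply: nth_prime_prime.
  by apply: leq_trans IH0; lia.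
by rewrite !addSnnS; split=> //; lia.
Qed.

(** * The lower bound *)

(** Induction on k: no prime lies strictly between two consecutive values of
    [nth_prime], so deleting [nth_prime k.+1] from the list lowers the bound by
    one index. *)
Lemma primes_below_nth_prime k (s : seq nat) :
  uniq s -> {in s, forall p, prime p && (p < nth_prime k.+1)} -> size s <= k.
Proof.
elim: k s => [|k IH] s uniq_s s_primes.
  case: s uniq_s s_primes => // p s _ /(_ p (mem_head p s)) /andP[pr_p].
  by rewrite ltnNge next_prime_le // prime_gt0.
apply: (@leq_trans (size (rem (nth_prime k.+1) s)).+1).
  have [in_s|notin_s] := boolP (nth_prime k.+1 \in s).
    by rewrite size_rem // leqSpred.
  by rewrite rem_id.
apply: IH; rewrite ?rem_uniq // => p; rewrite mem_rem_uniq // => /andP[/= p_neq].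
case/s_primes/andP=> pr_p lt_p; rewrite pr_p ltn_neqAle p_neq leqNgt /=.
by apply: contraL lt_p => lt_kp; rewrite -leqNgt next_prime_le.
Qed.

(** The map [pdiv] is injective on such a list: a common least prime factor
    would contradict coprimality, and only 1 has [pdiv] equal to 1. Removing
    that possible value 1 leaves distinct primes. *)
Lemma pairwise_coprime_size k (s : seq nat) :
  uniq s -> {in s, forall x, 0 < x < nth_prime k.+1} ->
  {in s &, forall x y, x != y -> coprime x y} -> size s <= k.+1.
Proof.
move=> uniq_s s_bound s_coprime.
have uniq_pdiv : uniq (map pdiv s).
  rewrite map_inj_in_uniq // => x y xs ys eq_pdiv.
  apply/eqP; apply: contraT => neq_xy.
  have : pdiv x %| gcdn x y by rewrite dvdn_gcd pdiv_dvd eq_pdiv pdiv_dvd.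
  rewrite (eqP (s_coprime x y xs ys neq_xy)) dvdn1 => /eqP pdiv_x1.
  have eq1 z : z \in s -> pdiv z = 1 -> z = 1.
    move=> /s_bound/andP[z_gt0 _] pdiv_z1; apply/eqP; rewrite eqn_leq z_gt0 leqNgt.
    by rewrite andbT; apply/negP => /pdiv_prime; rewrite pdiv_z1.
  by rewrite (eq1 x) // (eq1 y) // -?eq_pdiv in neq_xy.
have : size (rem 1 (map pdiv s)) <= k.
  apply: primes_below_nth_prime; first exact: rem_uniq.
  move=> p; rewrite mem_rem_uniq // => /andP[/= p_neq1 /mapP[x xs p_def]].
  have /andP[x_gt0 lt_x] := s_bound x xs.
  have x_gt1 : 1 < x.
    by rewrite ltn_neqAle x_gt0 andbT; apply: contra p_neq1; rewrite p_def => /eqP <-.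
  by rewrite p_def pdiv_prime //; apply: leq_ltn_trans lt_x; apply: pdiv_leq.
have [in_s|notin_s] := boolP (1 \in map pdiv s).
  by rewrite size_rem // size_map; lia.
by rewrite rem_id // size_map => /leqW.
Qed.

Lemma nth_prime_le_label (H : sgraph) n M :
  1 < n -> has_coprime_labeling (corona (complete_graph n) H) M ->
  nth_prime (n - 1) <= M.
Proof.
case: n => [|[|k]] // _ /andP[_ /existsP[f /and3P[/forallP f_gt0]]].
move=> /injectiveP f_inj /forallP f_edge; rewrite subn1 /= leqNgt; apply/negP => lt_M.
pose s := [seq (f (inl i) : nat) | i <- enum 'I_k.+2].
have : size s <= k.+1.
  apply: pairwise_coprime_size.
  - by rewrite map_inj_uniq ?enum_uniq // => i j /val_inj/f_inj [].
  - move=> _ /mapP[i _ ->]; rewrite f_gt0 /=.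
    by apply: leq_ltn_trans lt_M; rewrite -ltnS.
  - move=> _ _ /mapP[i _ ->] /mapP[j _ ->] neq_f.
    have /forallP/(_ (inl j))/implyP := f_edge (inl i); apply.
    by rewrite /= /complete_edge /=; apply: contraNneq neq_f => ->.
by rewrite size_map size_enum_ord ltnn.
Qed.

(** * The upper bound *)

(** A labeling of the corona, flattened to a list: entry 3i is the label of hub
    i, and entries 3i + 1 and 3i + 2 are the labels of its two pendants. *)
Definition corona_labels (n M : nat) (t : seq nat) : Prop :=
  [/\ size t = 3 * n, uniq t, {in t, forall x, 0 < x <= M},
      forall i j, i < n -> j < n -> i != j ->
        coprime (nth 0 t (3 * i)) (nth 0 t (3 * j)) &
      forall i u, i < n -> u < 2 ->
        coprime (nth 0 t (3 * i)) (nth 0 t (3 * i + u.+1))].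

Lemma has_coprime_labeling_of_corona_labels n M t :
  corona_labels n M t ->
  has_coprime_labeling (corona (complete_graph n) (empty_graph 2)) M.
Proof.
case=> size_t uniq_t t_bound hubs pendants.
pose G := corona (complete_graph n) (empty_graph 2).
pose pos (a : G) : nat :=
  match a with inl i => 3 * i | inr (i, u) => 3 * i + u.+1 end.
have pos_lt a : pos a < size t.
  rewrite size_t; case: a => [i|[i u]] /=; have := ltn_ord i; first lia.
  by have := ltn_ord u; lia.
have pos_inj : injective pos.
  move=> [i|[i u]] [j|[j v]] /= e.
  - by congr inl; apply: val_inj => /=; lia.
  - by have := ltn_ord v; lia.
  - by have := ltn_ord u; lia.
  - have := ltn_ord u; have := ltn_ord v => lt_v lt_u.
    by congr (inr (_, _)); apply: val_inj => /=; lia.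
have in_bound a : 0 < nth 0 t (pos a) <= M by apply/t_bound/mem_nth.
pose f := [ffun a : G => inord (nth 0 t (pos a)) : 'I_M.+1].
have fE a : f a = nth 0 t (pos a) :> nat.
  by rewrite ffunE inordK // ltnS; have /andP[] := in_bound a.
have f_inj : injective f.
  move=> a b /(congr1 val) /=; rewrite !fE => /eqP.
  by rewrite nth_uniq // => /eqP/pos_inj.
apply/andP; split.
  (* The value 0 is not taken, which leaves M values for distinct labels. *)
  rewrite -(card_codom f_inj).
  apply: (@leq_trans #|predC1 (ord0 : 'I_M.+1)|); last by rewrite cardC1 card_ord.
  apply/subset_leq_card/subsetP => _ /codomP[a ->].
  by rewrite inE -val_eqE /= -lt0n fE; have /andP[] := in_bound a.
apply/existsP; exists f; apply/and3P; split.
- by apply/forallP => a; rewrite fE; have /andP[] := in_bound a.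
- exact/injectiveP.
apply/forallP => a; apply/forallP => b; apply/implyP; rewrite !fE.
case: a b => [i|[i u]] [j|[j v]] /=.
- by move=> neq_ij; apply: hubs.
- by move=> /eqP <-; apply: pendants.
- by move=> /eqP ->; rewrite coprime_sym; apply: pendants.
- by rewrite andbF.
Qed.

(** The hubs are 1 and the primes up to 53. The pendants of the prime hubs are
    the composite numbers in increasing order, rearranged below 17 because 2
    needs odd pendants and 3 needs pendants prime to 3; this leaves 49, 50, 51
    and 52, two of which go to the hub 1. *)
Lemma base_corona_labels : exists t, corona_labels 17 53 t.
Proof.
exists [:: 1; 50; 52;   2; 9; 15;   3; 4; 8;     5; 6; 12;    7; 10; 16;
           11; 14; 18;  13; 20; 21; 17; 22; 24;  19; 25; 26;  23; 27; 28;
           29; 30; 32;  31; 33; 34; 37; 35; 36;  41; 38; 39;  43; 40; 42;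
           47; 44; 45;  53; 46; 48].
set t := (X in corona_labels _ _ X).
have hubs : all (fun i => all (fun j => (i != j) ==>
    coprime (nth 0 t (3 * i)) (nth 0 t (3 * j))) (iota 0 17)) (iota 0 17).
  by vm_compute.
have pendants : all (fun i => all (fun u =>
    coprime (nth 0 t (3 * i)) (nth 0 t (3 * i + u.+1))) (iota 0 2)) (iota 0 17).
  by vm_compute.
split.
- by vm_compute.
- by vm_compute.
- by apply/allP; vm_compute.
- move=> i j lt_i lt_j; apply/implyP.
  by move/allP/(_ i): hubs; rewrite mem_iota => /(_ lt_i)/allP/(_ j); rewrite mem_iota; apply.
- move=> i u lt_i lt_u.
  by move/allP/(_ i): pendants; rewrite mem_iota => /(_ lt_i)/allP/(_ u); rewrite mem_iota; apply.
Qed.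

Lemma prime_coprime_lt q x : prime q -> 0 < x < q -> coprime q x.
Proof. by move=> pr_q /andP[x_gt0 lt_x]; rewrite prime_coprime // gtnNdvd. Qed.

(** The count [3 * n.+1 <= q] is exactly what leaves two numbers below q outside
    the 3n labels in use: [q - 1 - 3 * n >= 2]. The old labels, being less than
    q, are coprime to it whatever they are, so nothing about the old hubs has to
    be carried through the induction besides the bound M < q. *)
Lemma extend_corona_labels n M q :
  prime q -> M < q -> 3 * n.+1 <= q ->
  (exists t, corona_labels n M t) -> exists t, corona_labels n.+1 q t.
Proof.
move=> pr_q lt_Mq le_q [t [size_t uniq_t t_bound hubs pendants]].
have t_lt x : x \in t -> 0 < x < q.
  by move=> /t_bound/andP[-> /leq_ltn_trans]; apply.
pose free := [seq x <- iota 1 q.-1 | x \notin t].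
have free_size : 2 <= size free.
  have := count_predC (mem t) (iota 1 q.-1).
  rewrite size_iota -!size_filter -/free.
  have : size [seq x <- iota 1 q.-1 | x \in t] <= size t.
    apply: uniq_leq_size; first exact/filter_uniq/iota_uniq.
    by move=> x; rewrite mem_filter => /andP[].
  rewrite size_t /=; move: (size _) => c.
  have -> : size [seq x <- iota 1 q.-1 | predC (mem t) x] = size free by [].
  lia.
have free_uniq : uniq free by exact/filter_uniq/iota_uniq.
have free_spec x : x \in free -> (x \notin t) && (0 < x < q).
  by rewrite mem_filter mem_iota => /andP[-> /=]; lia.
case: free free_size free_uniq free_spec => [|a [|b free]] // _ free_uniq free_spec.
have neq_ab : a != b by move: free_uniq; rewrite /= inE negb_or -andbA => /andP[].
have /andP[a_free a_bound] := free_spec a (mem_head _ _).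
have /andP[b_free b_bound] : (b \notin t) && (0 < b < q).
  by apply: free_spec; rewrite !inE eqxx orbT.
have new_hub i : i < n -> coprime q (nth 0 t (3 * i)).
  by move=> lt_i; apply/prime_coprime_lt/t_lt/mem_nth => //; rewrite size_t ltn_pmul2l.
exists [:: q, a, b & t]; split.
- by rewrite /= size_t; lia.
- rewrite /= !inE !negb_or neq_ab a_free b_free uniq_t !andbT /=.
  apply/and3P; split; [lia|lia|].
  by apply/negP => /t_lt; rewrite ltnn andbF.
- move=> x; rewrite !inE => /or4P[/eqP->|/eqP->|/eqP->|].
  + by rewrite prime_gt0 /=.
  + by case/andP: a_bound => -> /ltnW.
  + by case/andP: b_bound => -> /ltnW.
  + by move=> /t_lt/andP[-> /ltnW].
- move=> [|i] [|j] //; rewrite ?ltnS ?eqSS ?mulnS /=.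
  + by move=> _ lt_j _; apply: new_hub.
  + by move=> lt_i _ _; rewrite coprime_sym; apply: new_hub.
  + exact: hubs.
- move=> [|i] u; rewrite ?ltnS ?mulnS /=.
  + by case: u => [|[|u]] // _ _; apply: prime_coprime_lt.
  + exact: pendants.
Qed.

Lemma exists_corona_labels n :
  16 < n -> exists t, corona_labels n (nth_prime (n - 1)) t.
Proof.
case: n => // k; rewrite ltnS subn1 /=; elim: k => // k IH.
rewrite leq_eqVlt => /predU1P[<-|lt_k].
  by rewrite nth_prime16; apply: base_corona_labels.
apply: extend_corona_labels (IH lt_k).
- exact: nth_prime_prime.
- exact: ltn_nth_prime.
- exact/nth_prime_ge/ltnW.
Qed.

Theorem theorem8 (n : nat) (hn : 16 < n) :
  min_coprime_number (corona (complete_graph n) (empty_graph 2)) =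
  nth_prime (n - 1).
Proof.
rewrite /min_coprime_number; case: ex_minnP => M labelM minM.
apply/eqP; rewrite eqn_leq; apply/andP; split.
  have [t t_labels] := exists_corona_labels n hn.
  exact/minM/has_coprime_labeling_of_corona_labels/t_labels.
by apply: nth_prime_le_label labelM; apply: leq_trans hn.
Qed.
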